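(* Every binary pattern $P$ that contains none of $Q_1,Q_2,Q_3,Q_4$ as an interval minor is row-bounding, i.e., $\mathrm{Av}(P)$ is row-bounded. Here $Q_1,\dots,Q_4\in\{0,1\}^{3\times3}$ have supports $\{(1,2),(2,1),(3,3)\}$, $\{(1,2),(2,3),(3,1)\}$, $\{(1,1),(2,3),(3,2)\}$, $\{(1,3),(2,1),(3,2)\}$ respectively.
   Context: All matrices are binary; rows are numbered top to bottom, columns left to right; $(i,j)$ is the entry in row $i$, column $j$, a 1-entry if it equals 1; $\mathrm{supp}$ is the set of 1-entries. For integers, $(a,b]=\{a+1,\dots,b\}$. A pattern $P\in\{0,1\}^{k\times\ell}$ is an interval minor of $M\in\{0,1\}^{m\times n}$ if there are integers $0=r_0<\dots<r_k=m$ and $0=c_0<\dots<c_\ell=n$ such that for each 1-entry $(i,j)$ of $P$ the submatrix of $M$ on rows $(r_{i-1},r_i]$ and columns $(c_{j-1},c_j]$ contains a 1-entry; otherwise $M$ avoids $P$. $\mathrm{Av}(P)$ is the set of binary matrices avoiding $P$. A matrix $M\in\mathcal C$ is critical for $\mathcal C$ if changing any single 0-entry of $M$ into a 1-entry gives a matrix outside $\mathcal C$. A horizontal 0-run is a maximal set of consecutive 0-entries within a single row; the complexity of a row is the number of horizontal 0-runs in it. The row-complexity of $\mathcal C$ is the supremum over matrices critical for $\mathcal C$ of the maximum complexity of a row; $\mathcal C$ is row-bounded if it is finite. *)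

(* Defs.v *)
(* Binary matrices are 'M[bool]_(m, n); indices are 0-based
   ordinals, so the paper's entry (i,j) is our entry (i-1, j-1). *)
From mathcomp Require Import all_boot all_algebra.
Set Implicit Arguments. Unset Strict Implicit. Unset Printing Implicit Defensive.

Definition boundaries (k m : nat) (r : nat -> nat) : Prop :=
  r 0 = 0 /\ r k = m /\ (forall i, i < k -> r i < r i.+1).

(* P (k x l) is an interval minor of M (m x n): block (i,j) (0-based) consists
   of rows r_i <= a < r_{i+1} (= paper's (r_{i}, r_{i+1}] with 1-based rows)
   and columns c_j <= b < c_{j+1}. *)
Definition interval_minor (k l m n : nat) (P : 'M[bool]_(k, l)) (M : 'M[bool]_(m, n)) : Prop :=
  exists r c : nat -> nat,
    boundaries k m r /\ boundaries l n c /\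
    forall (i : 'I_k) (j : 'I_l), P i j ->
      exists (a : 'I_m) (b : 'I_n),
        (r i <= a < r i.+1) /\ (c j <= b < c j.+1) /\ M a b.

Definition mclass := forall m n : nat, 'M[bool]_(m, n) -> Prop.

Definition Av (k l : nat) (P : 'M[bool]_(k, l)) : mclass :=
  fun m n M => ~ interval_minor P M.

Definition set1 (m n : nat) (M : 'M[bool]_(m, n)) (a : 'I_m) (b : 'I_n) : 'M[bool]_(m, n) :=
  \matrix_(i, j) (if (i == a) && (j == b) then true else M i j).

Definition critical (C : mclass) (m n : nat) (M : 'M[bool]_(m, n)) : Prop :=
  C m n M /\ forall (a : 'I_m) (b : 'I_n), M a b = false -> ~ C m n (set1 M a b).

(* Number of horizontal 0-runs in row a: count the 0-entries that start a run,
   i.e. those in column 0 or preceded by a 1-entry. *)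
Definition row_complexity (m n : nat) (M : 'M[bool]_(m, n)) (a : 'I_m) : nat :=
  #|[set j : 'I_n | ~~ M a j &&
      ((val j == 0) || [exists j' : 'I_n, ((val j').+1 == val j) && M a j'])]|.

Definition row_bounded (C : mclass) : Prop :=
  exists B : nat, forall (m n : nat) (M : 'M[bool]_(m, n)),
    critical C M -> forall a : 'I_m, row_complexity M a <= B.

Definition pattern_of (s : seq (nat * nat)) : 'M[bool]_(3, 3) :=
  \matrix_(i, j) ((val i, val j) \in s).

(* Supports given 1-based in the paper; here 0-based. *)
Definition Q1 := pattern_of [:: (0, 1); (1, 0); (2, 2)].
Definition Q2 := pattern_of [:: (0, 1); (1, 2); (2, 0)].
Definition Q3 := pattern_of [:: (0, 0); (1, 2); (2, 1)].
Definition Q4 := pattern_of [:: (0, 2); (1, 0); (2, 1)].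

(* Main.v *)
(* The three-element transversals of P are monotone.  In a row a of a critical
   matrix M, each 0-run is explained by a placement of P in M that fails only
   at one 1-entry e of P, whose block meets row a inside that 0-run.  If there
   are many 0-runs, the same e serves many times, and two placements s < t are
   glued: what lies left of e is taken from s, what lies right of it from t, and
   the 1-entries of row a separating the two serve e and the other entries of
   its row.  The obstruction is that s and t cut the rows differently.  It is
   overcome according to which of the four quadrants around e are occupied:
   monotonicity forces entries of P in two adjacent quadrants into a single
   line, whose block may be enlarged to the union of its blocks in s and t.  In
   the remaining case, where both e's row and one other row p are used on both
   sides, the placement t whose row block p reaches lowest (closest to a) is
   kept, and row p is served on one side of e by 1-entries found near many other
   placements. *)
Require Import Defs.
From mathcomp Require Import all_boot all_algebra.
From mathcomp Require Import zify.
From Stdlib Require Import Classical.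
Set Implicit Arguments. Unset Strict Implicit. Unset Printing Implicit Defensive.

(** * Placements, probes and forcing positions *)

(* Matrices and patterns are handled as predicates on [nat], false outside their
   box when that matters; see [entry]. *)
Definition hits (M : nat -> nat -> bool) (r c : nat -> nat) (i j : nat) : Prop :=
  exists a b, [/\ r i <= a < r i.+1, c j <= b < c j.+1 & M a b].

Definition minor k l (P : nat -> nat -> bool) m n (M : nat -> nat -> bool) : Prop :=
  exists r c, [/\ boundaries k m r, boundaries l n c
    & forall i j, P i j -> hits M r c i j].

(* The [N] placements [(R t, C t)] fail only at [(i, j)]; the block [(i, j)] of
   the [t]-th one lies strictly between the 1-entries [y t] and [y t.+1] of row
   [a], so that the blocks move to the right as [t] grows. *)
Record probes N k l (P : nat -> nat -> bool) i j m n (M : nat -> nat -> bool) a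
    (y : nat -> nat) (R C : nat -> nat -> nat) : Prop := Probes {
  probe_rows : forall t, t < N -> boundaries k m (R t);
  probe_cols : forall t, t < N -> boundaries l n (C t);
  probe_row : forall t, t < N -> R t i <= a < R t i.+1;
  probe_col : forall t, t < N -> (y t < C t j) && (C t j.+1 <= y t.+1);
  probe_one : forall t, t <= N -> M a (y t);
  probe_hits : forall t, t < N -> forall i' j', P i' j' ->
    (i' != i) || (j' != j) -> hits M (R t) (C t) i' j' }.

Definition forcing k l (P : nat -> nat -> bool) i j : Prop :=
  exists N, forall m n M a y R C,
    probes N k l P i j m n M a y R C -> minor k l P m n M.

Definition in_box k l (P : nat -> nat -> bool) : Prop :=
  forall i j, P i j -> (i < k) && (j < l).

Definition monotone_triples (P : nat -> nat -> bool) : Prop :=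
  forall i1 i2 i3 j1 j2 j3, P i1 j1 -> P i2 j2 -> P i3 j3 ->
    i1 < i2 < i3 -> [&& j1 != j2, j2 != j3 & j1 != j3] ->
    (j1 < j2 < j3) || (j3 < j2 < j1).

(** * Block boundaries *)

Lemma bd_lt k m r x y : boundaries k m r -> x < y <= k -> r x < r y.
Proof.
case=> _ [_ rS]; elim: y => [|y IH] h; first lia.
have := rS y; case: (ltngtP x y) => [xy|xy|->]; [have := IH | |]; lia.
Qed.

Lemma bd_le k m r x y : boundaries k m r -> x <= y <= k -> r x <= r y.
Proof.
move=> rb; case: (ltngtP x y) => [xy|xy|->] h; [have := bd_lt rb (x := x) (y := y)| |]; lia.
Qed.

Lemma bd_ge k m r x : boundaries k m r -> x <= k -> x <= r x.
Proof. by move=> rb; elim: x => [//|x IH] h; have := bd_lt rb (x := x) (y := x.+1); lia. Qed.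

Lemma bd_end k m r x : boundaries k m r -> x < k -> r x.+1 <= m.
Proof. by move=> rb h; have := bd_le rb (x := x.+1) (y := k); case: rb => _ [-> _]; lia. Qed.

Definition covers (r r' : nat -> nat) i := (r i <= r' i) && (r' i.+1 <= r i.+1).

Lemma hits_covers M r c r' c' i j :
  hits M r' c' i j -> covers r r' i -> covers c c' j -> hits M r c i j.
Proof. by rewrite /covers => -[a [b [ha hb hM]]] hr hc; exists a, b; split=> //; lia. Qed.

(** * Gluing two placements *)

Section Probes.
Context (N k l : nat) (P : nat -> nat -> bool) (i j m n : nat) (M : nat -> nat -> bool)
  (a : nat) (y : nat -> nat) (R C : nat -> nat -> nat).
Hypothesis pb : probes N k l P i j m n M a y R C.
Hypotheses (Pk : in_box k l P) (Pij : P i j).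

Lemma probe_lt_l : j < l. Proof. by have := Pk Pij; lia. Qed.
Lemma probe_lt_k : i < k. Proof. by have := Pk Pij; lia. Qed.

Lemma one_lt u v : u < v <= N -> y u < y v.
Proof.
elim: v => [|v IH] h; first lia.
have jl := probe_lt_l.
have := probe_col pb (t := v); have := bd_lt (probe_cols pb (t := v) _) (x := j) (y := j.+1).
by case: (ltngtP u v) => [xy|xy|->]; [have := IH | |]; lia.
Qed.

Lemma one_le u v : u <= v <= N -> y u <= y v.
Proof. by move=> h; have := @one_lt u v; case: (ltngtP u v) h => [||->]; lia. Qed.

Lemma one_lt_n u : u < N -> y u < n.
Proof.
move=> h; have := probe_col pb h; have jl := probe_lt_l.
have := bd_end (probe_cols pb h) jl; have := bd_lt (probe_cols pb h) (x := j) (y := j.+1).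
by lia.
Qed.

(* The columns [<= ql] come from [s], those [>= qr] from [t]; the columns from
   [ql] to [qr] are served in row [a] by the 1-entries between the two. *)
Lemma glue s t r ql qr : s + l < t -> t < N ->
  boundaries k m r -> r i <= a < r i.+1 -> ql <= j <= qr -> qr < l ->
  (forall i' j', P i' j' -> i' != i -> j' < j -> (j' <= ql) && covers r (R s) i') ->
  (forall i' j', P i' j' -> i' != i -> j < j' -> (qr <= j') && covers r (R t) i') ->
  (forall i', P i' j -> i' != i ->
     (ql == j) && covers r (R s) i' || (qr == j) && covers r (R t) i') ->
  (forall j', P i j' -> j' < ql -> covers r (R s) i) ->
  (forall j', P i j' -> qr < j' -> covers r (R t) i) ->
  minor k l P m n M.
Proof.
move=> st tN rb ra qj qrl HL HR HU Hl Hr.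
(* Boundary [ql] still comes from [s] and boundary [qr.+1] already from [t]; each block from [ql] to
   [qr] holds its own [y (s.+1 + (q - ql))]. The gap [s + l < t] provides enough of these. *)
pose c q := if q <= ql then C s q else if q <= qr then y (s.+1 + (q - ql)) else C t q.
have sN : s < N by lia.
have cs := probe_cols pb sN; have ct := probe_cols pb tN.
have ps := probe_col pb sN; have pt := probe_col pb tN.
have Csj := bd_lt cs (x := j) (y := j.+1); have Ctj := bd_lt ct (x := j) (y := j.+1).
have Yt u : s < u -> u <= s + l -> (y s.+1 <= y u) && (y u < y t).
  by move=> h1 h2; have := @one_le s.+1 u; have := @one_lt u t; lia.
have cb : boundaries l n c.
  split; first by rewrite /c; case: cs => -> _.
  split; first by rewrite /c !ifF; [case: ct => _ [-> _] | lia | lia].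
  move=> q ql'; rewrite /c.
  have := bd_lt cs (x := q) (y := q.+1); have := bd_lt ct (x := q) (y := q.+1).
  have := bd_le cs (x := q) (y := j); have := bd_le ct (x := j.+1) (y := q.+1).
  have := Yt (s.+1 + (q - ql)); have := Yt (s.+1 + (q.+1 - ql)).
  have := @one_lt (s.+1 + (q - ql)) (s.+1 + (q.+1 - ql)).
  by case: (leqP q ql); case: (leqP q qr); case: (leqP q.+1 ql); case: (leqP q.+1 qr); lia.
(* Block [ql] can only grow to the right, since [y s.+1] is not left of the end of block [j] of [s].
   Symmetrically for [qr] and [t]. *)
have cL q : q <= ql -> covers c (C s) q.
  move=> h; rewrite /covers /c.
  have := bd_le cs (x := q.+1) (y := j.+1); have := bd_le cs (x := q.+1) (y := j).
  have := bd_le ct (x := j.+1) (y := q.+1); have := Yt (s.+1 + (q.+1 - ql)).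
  have := one_lt (u := s.+1) (v := t).
  by case: (leqP q ql); case: (leqP q.+1 ql); case: (leqP q.+1 qr); lia.
have cR q : qr <= q -> q < l -> covers c (C t) q.
  move=> h h'; rewrite /covers /c.
  have := bd_le cs (x := q) (y := j); have := bd_le ct (x := j) (y := q).
  have := Yt (s.+1 + (q - ql)); have := one_lt (u := s.+1) (v := t).
  by case: (leqP q ql); case: (leqP q qr); case: (leqP q.+1 ql); case: (leqP q.+1 qr); lia.
have cY q : ql <= q <= qr -> exists2 u, u <= N & c q <= y u < c q.+1.
  move=> h; exists (s.+1 + (q - ql)); first lia.
  rewrite /c.
  have := bd_le cs (x := q) (y := j); have := bd_le ct (x := j.+1) (y := q.+1).
  have := Yt (s.+1 + (q - ql)); have := @one_lt (s.+1 + (q - ql)) (s.+1 + (q.+1 - ql)).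
  by case: (leqP q ql); case: (leqP q qr); case: (leqP q.+1 ql); case: (leqP q.+1 qr); lia.
exists r, c; split=> // i' j' Pij'.
have jl := Pk Pij'.
case: (eqVneq i' i) => [ii|ii].
  subst i'.
  have [h|h] := ltnP j' ql.
    by apply: hits_covers (Hl _ Pij' h) (cL _ _); [apply: (probe_hits pb sN)|]; lia.
  have [h2|h2] := ltnP qr j'.
    by apply: hits_covers (Hr _ Pij' h2) (cR _ _ _); [apply: (probe_hits pb tN)| |]; lia.
  have [|u uN hu] := cY j'; first lia.
  by exists a, (y u); split=> //; apply: (probe_one pb).
have [h|h|h] := ltngtP j' j.
- have /andP[h1 h2] := HL _ _ Pij' ii h.
  by apply: hits_covers h2 (cL _ h1); apply: (probe_hits pb sN); rewrite ?ii.
- have /andP[h1 h2] := HR _ _ Pij' ii h.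
  by apply: hits_covers h2 (cR _ h1 _); [apply: (probe_hits pb tN); rewrite ?ii | lia].
- subst j'; case/orP: (HU _ Pij' ii) => /andP[/eqP h1 h2].
    by apply: hits_covers h2 (cL _ _); [apply: (probe_hits pb sN); rewrite ?ii | lia].
  by apply: hits_covers h2 (cR _ _ _); [apply: (probe_hits pb tN); rewrite ?ii | lia | lia].
Qed.

End Probes.

(** One placement suffices: right of [j] only row [i] has entries, so the columns there can be recut
    at 1-entries of row [a], while block [j] grows to the right until it contains [y 1]. *)
Lemma forcing_no_right k l P i j : in_box k l P -> P i j ->
  (forall i' j', P i' j' -> j < j' -> i' = i) -> forcing k l P i j.
Proof.
move=> Pk Pij nr; exists l.+2 => m n M a y R C pb.
have jl := probe_lt_l Pk Pij.
have r0 := probe_rows pb (ltn0Sn _); have c0 := probe_cols pb (ltn0Sn _).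
pose c q := if q <= j then C 0 q else if q < l then y (1 + (q - j)) else n.
have p0 := probe_col pb (ltn0Sn _).
have y1 u : 1 < u -> u < l.+2 -> (y 1 < y u) && (y u < n).
  by move=> h1 h2; rewrite (one_lt pb Pk Pij) ?(one_lt_n pb Pk Pij) //; lia.
have y1n : y 1 < n by apply: (one_lt_n pb Pk Pij).
have Cj := bd_lt c0 (x := j) (y := j.+1).
have cb : boundaries l n c.
  split; first by rewrite /c; case: c0 => -> _.
  split; first by rewrite /c ltnn !ifF //; lia.
  move=> q ql; rewrite /c.
  have := bd_lt c0 (x := q) (y := q.+1); have := bd_le c0 (x := q) (y := j).
  have := y1 (1 + (q - j)); have := y1 (1 + (q.+1 - j)).
  have := one_lt pb Pk Pij (u := 1 + (q - j)) (v := 1 + (q.+1 - j)).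
  by case: (leqP q j); case: (leqP q.+1 j); case: (ltnP q l); case: (ltnP q.+1 l); lia.
exists (R 0), c; split=> // i' j' Pij'; have jl' := Pk _ _ Pij'.
have [h|h] := ltnP j' j.
  have := probe_hits pb (ltn0Sn _) Pij'; have -> : (i' != i) || (j' != j) by lia.
  move=> /(_ isT); rewrite /hits /c.
  have -> : j' <= j by lia.
  by have -> : j'.+1 <= j by lia.
have [ii|ii] := eqVneq i' i.
  subst i'; exists a, (y (1 + (j' - j))); split.
  - exact: (probe_row pb).
  - rewrite /c; have := one_lt pb Pk Pij (u := 1 + (j' - j)) (v := 1 + (j'.+1 - j)).
    have := y1 (1 + (j' - j)).
    have [e|e] := eqVneq j' j; last first.
      by case: (leqP j' j); case: (leqP j'.+1 j); case: (ltnP j' l); case: (ltnP j'.+1 l); lia.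
    subst j'; rewrite leqnn subnn addn0.
    by case: (leqP j.+1 j); case: (ltnP j.+1 l); lia.
  - apply: (probe_one pb); lia.
have ej : j' = j by have := nr _ _ Pij'; lia.
subst j'; apply: hits_covers (probe_hits pb (ltn0Sn _) Pij' _) _ _; rewrite ?ii //.
  by rewrite /covers !leqnn.
rewrite /covers /c leqnn leqnn ltnn /=; have := y1 2.
have := bd_end c0 jl; have -> : 1 + (j.+1 - j) = 2 by lia.
by case: (ltnP j.+1 l); lia.
Qed.

(** * Serving a second row from nearby placements *)

(* Otherwise the part of the placement left of [j] could be pushed left of some
   1-entry of row [a], which would then serve [(i, j)]. *)
Lemma top_near N k l P i j m n M a y R C s p :
  probes N k l P i j m n M a y R C -> in_box k l P -> P i j ->
  ~ minor k l P m n M -> l.+2 <= s < N -> p != i ->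
  (exists2 q, P p q & q < j) ->
  (forall i' j', P i' j' -> j' < j -> (i' == p) || (i' == i)) ->
  exists a' b, [/\ R s p <= a' < R s p.+1, y (s - l.+2) <= b < y s.+1 & M a' b].
Proof.
move=> pb Pk Pij nm sN pi exq left_rows; apply: NNPP => none; apply: nm.
have jl := probe_lt_l Pk Pij.
(* [q1] is the last entry of row [p] left of [j]; strictly between [q1] and [j] only row [i] is
   occupied. *)
have [q1 Pq1 q1max] : exists2 q1, P p q1 && (q1 < j)
    & forall q, P p q -> q < j -> q <= q1.
  have ex : exists q, P p q && (q < j) by case: exq => q h1 h2; exists q; rewrite h1.
  have ub q : P p q && (q < j) -> q <= l by case/andP => _; lia.
  case: (ex_maxnP ex ub) => q1 h1 h2; exists q1 => // q h3 h4.
  by apply: h2; rewrite h3.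
case/andP: Pq1 => Pq1 q1j.
have sN' : s < N by lia.
have cs := probe_cols pb sN'; have ps := probe_col pb sN'.
have Cj := bd_lt cs (x := j) (y := j.+1).
have yle u v := @one_le _ _ _ _ _ _ _ _ _ _ _ _ _ pb Pk Pij u v.
have ylt u v := @one_lt _ _ _ _ _ _ _ _ _ _ _ _ _ pb Pk Pij u v.
have [a' [b [ha' hb Mb]]] := probe_hits pb sN' Pq1 (introT orP (or_introl pi)).
(* Otherwise [b] would itself lie in the window that [none] declares empty. *)
have by1 : b < y (s - l.+2).
  rewrite ltnNge; apply/negP => h; apply: none; exists a', b; split=> //.
  by have := bd_le cs (x := q1.+1) (y := j); have := yle s s.+1; lia.
(* Block [q1] keeps [b], and block [j] now starts at some [y] before [y s], so row [a] serves
   [(i, j)]. The window reaches back [l.+2] probes to leave room for these cuts. *)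
pose c q := if q <= q1 then C s q else if q <= j then y (s - l.+2 + (q - q1)) else C s q.
have y0 u : u <= l -> (y (s - l.+2) <= y (s - l.+2 + u)) && (y (s - l.+2 + u) < y s).
  by move=> h; have := yle (s - l.+2) (s - l.+2 + u); have := ylt (s - l.+2 + u) s; lia.
have cb : boundaries l n c.
  split; first by rewrite /c; case: cs => -> _.
  split; first by rewrite /c !ifF; [case: cs => _ [-> _] | lia | lia].
  move=> q ql; rewrite /c.
  have := bd_lt cs (x := q) (y := q.+1); have := bd_le cs (x := q) (y := q1).
  have := bd_le cs (x := j.+1) (y := q.+1).
  have := y0 (q - q1); have := y0 (q.+1 - q1).
  have := ylt (s - l.+2 + (q - q1)) (s - l.+2 + (q.+1 - q1)).
  by case: (leqP q q1); case: (leqP q j); case: (leqP q.+1 q1); case: (leqP q.+1 j); lia.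
exists (R s), c; split=> //; first exact: (probe_rows pb).
move=> i' j' Pij'; have jl' := Pk _ _ Pij'.
have [h|h] := ltnP j' q1.
  have := probe_hits pb sN' Pij'; have -> : (i' != i) || (j' != j) by lia.
  move=> /(_ isT); rewrite /hits /c.
  have -> : j' <= q1 by lia.
  by have -> : j'.+1 <= q1 by lia.
have [h2|h2] := ltnP j j'.
  have := probe_hits pb sN' Pij'; have -> : (i' != i) || (j' != j) by lia.
  move=> /(_ isT); rewrite /hits /c !ifF //; lia.
have [ii|ii] := eqVneq i' i.
  subst i'; exists a, (y (s - l.+2 + (j' - q1))); split.
  - exact: (probe_row pb).
  - rewrite /c; have := ylt (s - l.+2 + (j' - q1)) (s - l.+2 + (j'.+1 - q1)).
    have := bd_le cs (x := j') (y := q1).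
    have := bd_le cs (x := j.+1) (y := j'.+1); have := y0 (j' - q1).
    by case: (leqP j' q1); case: (leqP j' j); case: (leqP j'.+1 q1); case: (leqP j'.+1 j); lia.
  - apply: (probe_one pb); lia.
have [jj|jj] := eqVneq j' j.
  subst j'; apply: hits_covers (probe_hits pb sN' Pij' _) _ _; rewrite ?ii //.
    by rewrite /covers !leqnn.
  have := y0 (j - q1).
  by rewrite /covers /c leqnn; case: (leqP j q1); case: (leqP j.+1 j); case: (leqP j.+1 q1); lia.
have ip : i' = p by have := left_rows _ _ Pij'; lia.
subst i'; have jq : j' = q1 by have := q1max _ Pij'; lia.
subst j'; exists a', b; split=> //.
have := y0 (q1.+1 - q1); rewrite /c leqnn ltnn.
by case: (leqP q1.+1 j); lia.
Qed.

Lemma exists_argmax N (f : nat -> nat) : 0 < N ->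
  exists2 t, t < N & forall s, s < N -> f s <= f t.
Proof.
elim: N => // N IH _; case: N IH => [|N] IH; first by exists 0 => // -[].
have [//|t tN tmax] := IH.
have [h|h] := leqP (f N.+1) (f t).
  exists t; first lia.
  by move=> s; rewrite ltnS leq_eqVlt => /predU1P[->//|]; apply: tmax.
exists N.+1 => // s; rewrite ltnS leq_eqVlt => /predU1P[->//|/tmax]; lia.
Qed.

(** * Row partitions combined from two placements *)

(* Rows above [p] are reduced to height one, which enlarges block [p]; this is
   used when [P] has no entry above row [p]. *)
Definition mix p i (ru rl : nat -> nat) q :=
  if q <= p then q else if q <= i then ru q else rl q.

(** Both switches keep the boundaries increasing: at [p] because boundary [q] is always at least
    [q], at [i] because row [a] lies between [ru i] and [rl i.+1]. *)
Lemma mix_bd p i a k m ru rl : p <= i < k -> boundaries k m ru -> boundaries k m rl ->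
  ru i <= a -> a < rl i.+1 -> boundaries k m (mix p i ru rl).
Proof.
move=> pik bu bl ha ha'; split; first by rewrite /mix.
split; first by rewrite /mix !ifF; [case: bl => _ [] | lia | lia].
move=> q qk; rewrite /mix.
have := bd_lt bu (x := q) (y := q.+1); have := bd_lt bl (x := q) (y := q.+1).
have := bd_ge bu (x := q.+1); have := bd_ge bl (x := q.+1).
have := bd_le bu (x := q) (y := i); have := bd_le bl (x := i.+1) (y := q.+1).
by case: (leqP q p); case: (leqP q.+1 p); case: (leqP q i); case: (leqP q.+1 i); lia.
Qed.

Lemma mix_row p i a k m ru rl : p <= i < k -> boundaries k m ru ->
  ru i <= a -> a < rl i.+1 -> mix p i ru rl i <= a < mix p i ru rl i.+1.
Proof.
move=> pik bu ha ha'; rewrite /mix; have := bd_ge bu (x := i).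
by case: (leqP i p); case: (leqP i.+1 p); case: (leqP i i); case: (leqP i.+1 i); lia.
Qed.

(** For row [p] only the lower ends need comparing, as its upper end is already the least possible;
    hence the disjunction. *)
Lemma mix_covers_up p i k m ru rl r i' : i < k -> boundaries k m r ->
  p <= i' < i -> r i'.+1 <= ru i'.+1 -> (i' == p) || (ru i' <= r i') -> covers (mix p i ru rl) r i'.
Proof.
move=> ik br pi h1 h2; rewrite /covers /mix; have := bd_ge br (x := i').
by case: (leqP i' p); case: (leqP i'.+1 p); case: (leqP i' i); case: (leqP i'.+1 i); lia.
Qed.

Lemma mix_covers_down p i ru rl i' : p <= i < i' -> covers (mix p i ru rl) rl i'.
Proof.
move=> pi; rewrite /covers /mix.
by case: (leqP i' p); case: (leqP i'.+1 p); case: (leqP i' i); case: (leqP i'.+1 i); lia.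
Qed.

Lemma mix_covers_mid p i r : p < i -> covers (mix p i r r) r i.
Proof.
move=> pi; rewrite /covers /mix leqnn.
by case: (leqP i p); case: (leqP i.+1 p); case: (leqP i.+1 i); lia.
Qed.

(* The placement [t] maximizing [R t p.+1] accepts the 1-entries that any other
   placement uses in row [p]; at least [l] other placements lie on one side of
   [t], far enough apart to serve one column each. *)
Lemma forcing_two_rows k l P i j p : in_box k l P -> P i j -> p < i ->
  (exists2 q, P p q & q < j) ->
  (forall i' j', P i' j' -> j' != j -> (i' == p) || (i' == i)) ->
  (forall i', P i' j -> p <= i') ->
  forcing k l P i j.
Proof.
move=> Pk Pij pi exq side col.
(* [near] at [s] spans the indices from [s - l.+2] to [s.+1], hence [l + 3] steps. [N] is large
   enough for [l] such windows on one side of any [t]. *)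
pose D := l + 3; exists (D * l + (D * l + D + 10)) => m n M a y R C pb.
apply: NNPP => nm; apply: (nm).
have jl := probe_lt_l Pk Pij; have ik := probe_lt_k Pk Pij.
set N := D * l + _ in pb.
have DE : D = l + 3 by [].
have NE : N = D * l + (D * l + D + 10) by [].
clearbody N D.
have yle u v := @one_le _ _ _ _ _ _ _ _ _ _ _ _ _ pb Pk Pij u v.
have ylt u v := @one_lt _ _ _ _ _ _ _ _ _ _ _ _ _ pb Pk Pij u v.
have N0 : 0 < N by lia.
have [t tN tmax] := exists_argmax (fun s => R s p.+1) N0.
(* The row found is below [R s p.+1], hence below [R t p.+1] by maximality; collapsing the rows
   above [p] takes care of the other end. *)
have near s : l.+2 <= s < N -> exists a' b,
    [/\ p <= a' < R t p.+1, y (s - l.+2) <= b < y s.+1 & M a' b].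
  move=> sN; have [|//|i' j' h1 h2|a' [b [h1 h2 h3]]] := top_near pb Pk Pij nm sN (p := p).
  - lia.
  - by apply: side => //; lia.
  - exists a', b; split=> //.
    have sN' : s < N by lia.
    by have := tmax _ sN'; have := bd_ge (probe_rows pb sN') (x := p); lia.
have rt := probe_rows pb tN; have ct := probe_cols pb tN.
have ta := probe_row pb tN; have pt := probe_col pb tN.
have Cj := bd_lt ct (x := j) (y := j.+1).
pose r := mix p i (R t) (R t).
have rb : boundaries k m r by apply: (@mix_bd _ _ a); lia || exact: rt.
have ra : r i <= a < r i.+1 by apply: (@mix_row _ _ _ k m); lia || exact: rt.
have rc i' : p <= i' -> covers r (R t) i'.
  move=> h; have [h1|h1|->] := ltngtP i' i; last exact: mix_covers_mid.
    by apply: (@mix_covers_up _ _ k m) => //; lia.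
  by apply: mix_covers_down; lia.
have rp : (r p == p) && (r p.+1 == R t p.+1).
  by rewrite /r /mix leqnn ltnn pi !eqxx.
have rowp i' j' : P i' j' -> p <= i'.
  by move=> h; have := side _ _ h; have := col i'; case: (eqVneq j' j) h => [->|]; lia.
have Dl q : q <= l -> D * q <= D * l by move=> h; rewrite leq_mul2l h orbT.
have keep c i' j' : P i' j' -> (i' != i) || (j' != j) -> covers c (C t) j' ->
    hits M r c i' j'.
  by move=> h1 h2; apply: hits_covers (probe_hits pb tN h1 h2) (rc _ (rowp _ _ h1)).
have fill c i' j' u s : P i' j' -> j' != j -> u < N -> c j' <= y u < c j'.+1 ->
    l.+2 <= s < N -> c j' <= y (s - l.+2) -> y s.+1 <= c j'.+1 -> hits M r c i' j'.
  move=> h1 h2 uN h3 sN h4 h5.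
  case/orP: (side _ _ h1 h2) => /eqP ->.
    have [a' [b [h6 h7 h8]]] := near _ sN.
    by exists a', b; split=> //; lia.
  by exists a, (y u); split=> //; apply: (probe_one pb); lia.
have [tl|tl] := leqP (D * l) t.
  (* Each column left of [j] becomes a full window, serving both row [p] and row [i]; block [j]
     reaches back to include a 1-entry of row [a]. *)
  pose c q := if q == 0 then 0 else if q <= j then y (D * q) else C t q.
  have cb : boundaries l n c.
    split; first by [].
    split; first by rewrite /c !ifF; [case: ct => _ [] | lia | lia].
    move=> q ql; rewrite /c /=.
    have := bd_lt ct (x := q) (y := q.+1); have := bd_le ct (x := j.+1) (y := q.+1).
    have := ylt (D * q) (D * q.+1); have := ylt 0 (D * q.+1).
    have := yle (D * q) t; have := Dl q; have := Dl q.+1; rewrite mulnS.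
    have := bd_ge ct (x := q.+1).
    by case: (leqP q j); case: (leqP q.+1 j); case: (eqVneq q 0) => [->|h]; lia.
  exists r, c; split=> // i' j' Pij'; have jl' := Pk _ _ Pij'.
  have [h|h|h] := ltngtP j' j; last first.
  - subst j'.
    have Dj := Dl j; have e0 : y (D * j) <= y t by apply: yle; lia.
    have [ii|ii] := eqVneq i' i; last first.
      apply: keep => //; first by rewrite ii.
      by rewrite /covers /c ltnn leqnn /=; case: eqP; lia.
    subst i'; exists a, (y (D * j)); split=> //.
      by rewrite /c ltnn leqnn /=; case: eqP; lia.
    by apply: (probe_one pb); lia.
  - apply: keep; rewrite ?h //; first lia.
    by rewrite /covers /c !ifF; lia.
  have e1 := Dl j'.+1; rewrite mulnS in e1.
  apply: (@fill c i' j' (D * j') (D * j' + l.+2)) => //; try lia.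
  - have := ylt (D * j') (D * j'.+1); rewrite /c /= mulnS.
    by case: (leqP j' j); case: (leqP j'.+1 j); case: (eqVneq j' 0) => h'; lia.
  - have -> : D * j' + l.+2 - l.+2 = D * j' by lia.
    by rewrite /c; case: eqP => // _; rewrite ifT //; lia.
  - by rewrite /c /= h mulnS; apply: yle; lia.
(* The windows now serve the columns right of [j], although [near] draws them from entries left of
   [j]. They start at [y t.+2], so that block [j] contains [y t.+1]. *)
pose c q := if q <= j then C t q else if q < l then y (t + 2 + D * (q - j.+1)) else n.
have yn u : u < N -> y u < n by move=> h; apply: (one_lt_n pb Pk Pij).
have tn : (y t.+1 < y t.+2) && (y t.+2 < n) by rewrite ylt ?yn //; lia.
have cb : boundaries l n c.
  split; first by rewrite /c; case: ct => -> _.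
  split; first by rewrite /c ltnn !ifF //; lia.
  move=> q ql; rewrite /c.
  have := bd_lt ct (x := q) (y := q.+1); have := bd_le ct (x := q) (y := j).
  have := yn (t + 2 + D * (q - j.+1)).
  have := yle (t + 2) (t + 2 + D * (q.+1 - j.+1)).
  have := ylt (t + 2 + D * (q - j.+1)) (t + 2 + D * (q.+1 - j.+1)).
  have -> : t + 2 = t.+2 by lia.
  have := Dl (q - j.+1); have := Dl (q.+1 - j.+1).
  have [h|h] := leqP q j.
    by case: (leqP q.+1 j); case: (ltnP q.+1 l); lia.
  have -> : q.+1 - j.+1 = (q - j.+1).+1 by lia.
  by rewrite mulnS; case: (leqP q.+1 j); case: (ltnP q l); case: (ltnP q.+1 l); lia.
exists r, c; split=> // i' j' Pij'; have jl' := Pk _ _ Pij'.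
have c1 : (c j == C t j) && (y t.+2 <= c j.+1).
  rewrite /c leqnn ltnn eqxx subnn muln0 addn0 addn2.
  by case: ltnP => _; lia.
have [h|h|h] := ltngtP j' j; last first.
- subst j'.
  have [ii|ii] := eqVneq i' i; last first.
    by apply: keep; rewrite ?ii // /covers; lia.
  subst i'; exists a, (y t.+1); split=> //.
    by have := ylt t t.+1; lia.
  by apply: (probe_one pb); lia.
- have e1 : D * (j' - j.+1) <= D * l by apply: Dl; lia.
  have e2 : c j' = y (t + 2 + D * (j' - j.+1)) by rewrite /c ifF ?ifT //; lia.
  have e4 : t + 2 + D * (j' - j.+1) + D < N by move: (D * l) (D * _) NE tl e1 => *; lia.
  have e3 : y (t + 2 + D * (j' - j.+1) + D) <= c j'.+1.
    rewrite /c ifF; last lia.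
    case: ltnP => h'; last exact/ltnW/yn.
    rewrite (_ : j'.+1 - j.+1 = (j' - j.+1).+1); last lia.
    have e5 : D * (j' - j.+1).+1 <= D * l by apply: Dl; lia.
    by move: e5; rewrite mulnS; move: (D * l) (D * (j' - j.+1)) NE tl => *; apply: yle; lia.
  move: (D * (j' - j.+1)) e2 e3 e4 => w e2 e3 e4.
  apply: (@fill c i' j' (t + 2 + w) (t + 2 + w + l.+2)) => //; try lia.
  - by rewrite e2 leqnn; apply: leq_trans e3; apply: ylt; lia.
  - have -> : t + 2 + w + l.+2 - l.+2 = t + 2 + w by lia.
    by rewrite e2.
  - by apply: leq_trans e3; apply: yle; lia.
- apply: keep => //; first lia.
  rewrite /covers /c.
  have -> : j' <= j by lia.
  by rewrite h !leqnn.
Qed.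

(** * Two opposite or three occupied quadrants *)

Lemma row_extent k l P i j : in_box k l P -> P i j ->
  exists ql qr, [/\ P i ql, P i qr, ql <= j <= qr, qr < l
    & forall j', P i j' -> ql <= j' <= qr].
Proof.
move=> Pk Pij.
have ex : exists j', P i j' by exists j.
have ub j' : P i j' -> j' <= l by move/Pk; lia.
have [ql h1 h2] := ex_minnP ex; have [qr h3 h4] := ex_maxnP ex ub.
exists ql, qr; split=> //; first by rewrite h2 ?h4.
- by have := Pk _ _ h3; lia.
- by move=> j' h; rewrite h2 ?h4.
Qed.

(** Triples through row [i] and an occupied quadrant put all entries above weakly left of row [i]'s
    entries and all entries below weakly right of them. So the left placement supplies the rows
    above, the right one those below. *)
Lemma forcing_diagonal k l P i j : in_box k l P -> monotone_triples P -> P i j ->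
  (exists i' j', P i' j' && (i' < i) && (j' < j)) ->
  (exists i' j', P i' j' && (i < i') && (j < j')) ->
  (forall i' j', P i' j' -> i' < i -> j' <= j) ->
  (forall i' j', P i' j' -> i < i' -> j <= j') ->
  forcing k l P i j.
Proof.
move=> Pk mt Pij [i1 [j1 /andP[/andP[Pf fi fj]]]] [i2 [j2 /andP[/andP[Pz zi zj]]]] ne sw.
exists l.+2 => m n M a y R C pb.
have jl := probe_lt_l Pk Pij; have ik := probe_lt_k Pk Pij.
have [ql [qr [Pql Pqr qj qrl qq]]] := row_extent Pk Pij.
have sN : 0 < l.+2 by []. have tN : l.+1 < l.+2 by [].
have bs := probe_rows pb sN; have bt := probe_rows pb tN.
have as_ := probe_row pb sN; have at_ := probe_row pb tN.
apply: (glue pb Pk Pij (s := 0) (t := l.+1) (r := mix 0 i (R 0) (R l.+1)) _ _ _ _ qj) => //.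
- by apply: (@mix_bd _ _ a) => //; lia.
- by apply: (@mix_row _ _ _ k m) => //; lia.
- move=> i' j' h1 h2 h3; have := sw _ _ h1; have := mt _ _ _ _ _ _ h1 Pql Pz => g1 g2.
  by rewrite (@mix_covers_up _ _ k m) ?leqnn ?orbT //; lia.
- move=> i' j' h1 h2 h3; have := ne _ _ h1; have := mt _ _ _ _ _ _ Pf Pqr h1 => g1 g2.
  by rewrite mix_covers_down; lia.
- move=> i' h1 h2; have [h|h] := ltnP i' i.
    have := mt _ _ _ _ _ _ h1 Pql Pz => g1.
    by rewrite (@mix_covers_up _ _ k m) ?leqnn ?orbT //; lia.
  have := mt _ _ _ _ _ _ Pf Pqr h1 => g1.
  by rewrite mix_covers_down; lia.
- by move=> j' h1 h2; have := qq _ h1; lia.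
- by move=> j' h1 h2; have := qq _ h1; lia.
Qed.

(** Monotonicity puts the entries above row [i] and off column [j] into one row [p], with none of
    column [j] above it. Only row [p] may be needed from both placements; the one whose block [p]
    reaches lower supplies the rows from [p] to [i]. *)
Lemma forcing_three_quadrants k l P i j : in_box k l P -> monotone_triples P -> P i j ->
  (exists i' j', P i' j' && (i' < i) && (j' < j)) ->
  (exists i' j', P i' j' && (i' < i) && (j < j')) ->
  (exists i' j', P i' j' && (i < i') && (j < j')) ->
  (forall i' j', P i' j' -> i < i' -> j <= j') ->
  forcing k l P i j.
Proof.
move=> Pk mt Pij [p [j1 /andP[/andP[Pf fi fj]]]] [p' [q /andP[/andP[Ph hi hj]]]]
  [i2 [j2 /andP[/andP[Pz zi zj]]]] sw.
have pp : p' = p.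
  by have := mt _ _ _ _ _ _ Pf Ph Pij; have := mt _ _ _ _ _ _ Ph Pf Pij; lia.
subst p'.
have nrow i' j' : P i' j' -> i' < i -> j' != j -> i' = p.
  move=> h1 h2 h3.
  have := mt _ _ _ _ _ _ Pf h1 Pij; have := mt _ _ _ _ _ _ h1 Pf Pij.
  have := mt _ _ _ _ _ _ Ph h1 Pij; have := mt _ _ _ _ _ _ h1 Ph Pij; lia.
have up i' : P i' j -> p <= i' by move=> h1; have := mt _ _ _ _ _ _ h1 Pf Pz; lia.
exists l.+2 => m n M a y R C pb.
have jl := probe_lt_l Pk Pij; have ik := probe_lt_k Pk Pij.
have [ql [qr [Pql Pqr qj qrl qq]]] := row_extent Pk Pij.
have sN : 0 < l.+2 by []. have tN : l.+1 < l.+2 by [].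
have bs := probe_rows pb sN; have bt := probe_rows pb tN.
have as_ := probe_row pb sN; have at_ := probe_row pb tN.
have HL i' j' : P i' j' -> i' != i -> j' < j -> (i' == p) && (j' <= ql).
  move=> h1 h2 h3; have := sw _ _ h1; have := nrow _ _ h1.
  by have := mt _ _ _ _ _ _ h1 Pql Pz; lia.
(* If the right placement reaches lower, all rows come from it, and column [j] as well, whence
   [qr := j]. *)
have [h|/ltnW h] := leqP (R 0 p.+1) (R l.+1 p.+1).
  apply: (glue pb Pk Pij (s := 0) (t := l.+1) (r := mix p i (R l.+1) (R l.+1))
    (ql := ql) (qr := j)) => //; try lia.
  - by apply: (@mix_bd _ _ a) => //; lia.
  - by apply: (@mix_row _ _ _ k m) => //; lia.
  - move=> i' j' h1 h2 h3; have /andP[/eqP -> ->] := HL _ _ h1 h2 h3.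
    by rewrite (@mix_covers_up _ _ k m) ?eqxx ?leqnn //; lia.
  - move=> i' j' h1 h2 h3; have := nrow _ _ h1 => g1; rewrite ltnW //=.
    have [h4|h4] := ltnP i' i; last by rewrite mix_covers_down; lia.
    by rewrite (@mix_covers_up _ _ k m) ?leqnn ?orbT //; lia.
  - move=> i' h1 h2; have := up _ h1 => g1; apply/orP; right; rewrite eqxx /=.
    have [h4|h4] := ltnP i' i; last by rewrite mix_covers_down; lia.
    by rewrite (@mix_covers_up _ _ k m) ?leqnn ?orbT //; lia.
  - by move=> j' h1 h2; have := qq _ h1; lia.
  - by move=> j' _ _; apply: mix_covers_mid.
apply: (glue pb Pk Pij (s := 0) (t := l.+1) (r := mix p i (R 0) (R l.+1)) _ _ _ _ qj) => //.
- by apply: (@mix_bd _ _ a) => //; lia.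
- by apply: (@mix_row _ _ _ k m) => //; lia.
- move=> i' j' h1 h2 h3; have /andP[/eqP -> ->] := HL _ _ h1 h2 h3.
  by rewrite (@mix_covers_up _ _ k m) ?eqxx ?leqnn //; lia.
- move=> i' j' h1 h2 h3; have := nrow _ _ h1 => g1.
  have qrj : qr <= j'.
    have := mt _ _ _ _ _ _ Pf Pqr Pz; have := mt _ _ _ _ _ _ Pf Pqr h1.
    by have := mt _ _ _ _ _ _ h1 Pij Pz; lia.
  rewrite qrj /=; have [h4|h4] := ltnP i' i; last by rewrite mix_covers_down; lia.
  have -> : i' = p by lia.
  by rewrite (@mix_covers_up _ _ k m) ?eqxx //; lia.
- move=> i' h1 h2; have := up _ h1 => g1; have [h4|h4] := ltnP i' i.
    have := mt _ _ _ _ _ _ h1 Pql Pz => g2.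
    by rewrite (@mix_covers_up _ _ k m) ?leqnn ?orbT //; lia.
  have := mt _ _ _ _ _ _ Pf Pqr h1 => g2.
  by rewrite mix_covers_down; lia.
- by move=> j' h1 h2; have := qq _ h1; lia.
- by move=> j' h1 h2; have := qq _ h1; lia.
Qed.

(** * Configurations needing two rows on both sides *)

(* Rows [p] and [p'] each receive the union of their two blocks, while every
   other row off [i] still contains its block from one of the two partitions. *)
Definition spread p i p' (r1 r2 : nat -> nat) q :=
  if (q <= p) || (i < q <= p') then minn (r1 q) (r2 q) else maxn (r1 q) (r2 q).

(** Only block [i] could degenerate, running from a maximum to a minimum; it survives because both
    partitions put [a] there. *)
Lemma spread_bd p i p' a k m r1 r2 : p < i <= p' -> i < k ->
  boundaries k m r1 -> boundaries k m r2 ->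
  r1 i <= a < r1 i.+1 -> r2 i <= a < r2 i.+1 -> p' < k ->
  boundaries k m (spread p i p' r1 r2) /\
    spread p i p' r1 r2 i <= a < spread p i p' r1 r2 i.+1.
Proof.
move=> pi ik b1 b2 h1 h2 pk; split; last first.
  by rewrite /spread; case: ifP; case: ifP; lia.
split; first by rewrite /spread; case: b1 b2 => -> _ [-> _]; rewrite minnn.
split; first by rewrite /spread; case: b1 b2 => _ [-> _] [_ [-> _]]; rewrite maxnn minnn; case: ifP.
move=> q qk; rewrite /spread.
have := bd_lt b1 (x := q) (y := q.+1); have := bd_lt b2 (x := q) (y := q.+1).
have [h|h] := eqVneq q i; first by subst q; case: ifP; case: ifP; lia.
by case: ifP; case: ifP; lia.
Qed.

(** If both ends are minima, the partition with the smaller lower-end boundary fits; if both are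
    maxima, the one with the larger upper-end boundary. *)
Lemma spread_covers p i p' r1 r2 i' : p < i <= p' -> i' != i ->
  covers (spread p i p' r1 r2) r1 i' || covers (spread p i p' r1 r2) r2 i'.
Proof. by move=> h1 h2; rewrite /covers /spread; case: ifP; case: ifP; lia. Qed.

Lemma spread_covers2 p i p' r1 r2 i' : p < i <= p' -> i' != i -> (i' == p) || (i' == p') ->
  covers (spread p i p' r1 r2) r1 i' && covers (spread p i p' r1 r2) r2 i'.
Proof. by move=> h1 h2; rewrite /covers /spread; case: ifP; case: ifP; lia. Qed.

(** If column [j] has an entry off row [i], then [excl] gives [ql = qr = j], so column block [j]
    contains both placements' blocks and either one may serve that entry. *)
Lemma forcing_spread k l P i j p p' : in_box k l P -> P i j -> p < i <= p' -> p' < k ->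
  (forall i' j', P i' j' -> i' != i -> j' != j -> (i' == p) || (i' == p')) ->
  (forall i' j' g, P i' j' -> i' != i -> P i g ->
     ((j' < j) ==> (j' <= g)) && ((j < j') ==> (g <= j'))) ->
  (forall i' j', P i' j -> i' != i -> P i j' -> j' = j) ->
  forcing k l P i j.
Proof.
move=> Pk Pij pi p'k rows cols excl.
exists l.+2 => m n M a y R C pb.
have jl := probe_lt_l Pk Pij; have ik := probe_lt_k Pk Pij.
have [ql [qr [Pql Pqr qj qrl qq]]] := row_extent Pk Pij.
have sN : 0 < l.+2 by []. have tN : l.+1 < l.+2 by [].
have bs := probe_rows pb sN; have bt := probe_rows pb tN.
have as_ := probe_row pb sN; have at_ := probe_row pb tN.
have [br ar] := spread_bd pi ik bs bt as_ at_ p'k.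
apply: (glue pb Pk Pij (s := 0) (t := l.+1) _ _ br ar qj) => //.
- move=> i' j' h1 h2 h3.
  have /andP[-> _] := @spread_covers2 _ _ _ (R 0) (R l.+1) _ pi h2 (rows _ _ h1 h2 (negbT (ltn_eqF h3))).
  by have := cols _ _ _ h1 h2 Pql; lia.
- move=> i' j' h1 h2 h3.
  have /andP[_ ->] := @spread_covers2 _ _ _ (R 0) (R l.+1) _ pi h2 (rows _ _ h1 h2 (negbT (gtn_eqF h3))).
  by have := cols _ _ _ h1 h2 Pqr; lia.
- move=> i' h1 h2; rewrite (excl _ _ h1 h2 Pql) (excl _ _ h1 h2 Pqr) !eqxx.
  exact: spread_covers.
- by move=> j' h1 h2; have := qq _ h1; lia.
- by move=> j' h1 h2; have := qq _ h1; lia.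
Qed.

Lemma forcing_north k l P i j : in_box k l P -> monotone_triples P -> P i j ->
  (exists i' j', P i' j' && (i' < i) && (j' < j)) ->
  (exists i' j', P i' j' && (i' < i) && (j < j')) ->
  (forall i' j', P i' j' -> i < i' -> j' = j) ->
  forcing k l P i j.
Proof.
move=> Pk mt Pij [p [j1 /andP[/andP[Pf fi fj]]]] [p' [q /andP[/andP[Ph hi hj]]]] south.
have pp : p' = p.
  by have := mt _ _ _ _ _ _ Pf Ph Pij; have := mt _ _ _ _ _ _ Ph Pf Pij; lia.
subst p'.
have rows i' j' : P i' j' -> j' != j -> (i' == p) || (i' == i).
  move=> h1 h3; have := south _ _ h1.
  have := mt _ _ _ _ _ _ Pf h1 Pij; have := mt _ _ _ _ _ _ h1 Pf Pij.
  have := mt _ _ _ _ _ _ Ph h1 Pij; have := mt _ _ _ _ _ _ h1 Ph Pij; lia.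
(* A second entry in row [i], together with row [p]'s entries on both sides, forbids entries of
   column [j] above [p]. *)
have [[g /andP[Pg gj]]|none] := classic (exists g, P i g && (g != j)).
  apply: (@forcing_two_rows _ _ _ _ _ p) => //; first by exists j1.
  move=> i' h1; have := mt _ _ _ _ _ _ h1 Ph Pg; have := mt _ _ _ _ _ _ h1 Pf Pg.
  have := mt _ _ _ _ _ _ h1 Ph Pg; lia.
have only g : P i g -> g = j.
  by move=> h; case: (eqVneq g j) => // gj; case: none; exists g; rewrite h.
(* With [p' = i], only row [p] has to receive a union. *)
apply: (@forcing_spread _ _ _ _ _ p i) => //.
- lia.
- by have := Pk _ _ Pij; lia.
- by move=> i' j' h1 h2 h3; apply: rows h1 h3.
- by move=> i' j' g _ _ /only ->; lia.
- by move=> i' j' _ _; apply: only.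
Qed.

(** The upper quadrants share one row [p], the lower ones one row [p'], and the four corner entries
    yield the column conditions of [forcing_spread]. *)
Lemma forcing_four_quadrants k l P i j : in_box k l P -> monotone_triples P -> P i j ->
  (exists i' j', P i' j' && (i' < i) && (j' < j)) ->
  (exists i' j', P i' j' && (i' < i) && (j < j')) ->
  (exists i' j', P i' j' && (i < i') && (j' < j)) ->
  (exists i' j', P i' j' && (i < i') && (j < j')) ->
  forcing k l P i j.
Proof.
move=> Pk mt Pij [p [j1 /andP[/andP[Pf fi fj]]]] [i2 [j2 /andP[/andP[Ph hi hj]]]]
  [p' [j3 /andP[/andP[Pw wi wj]]]] [i4 [j4 /andP[/andP[Pz zi zj]]]].
have e2 : i2 = p by have := mt _ _ _ _ _ _ Pf Ph Pij; have := mt _ _ _ _ _ _ Ph Pf Pij; lia.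
have e4 : i4 = p' by have := mt _ _ _ _ _ _ Pij Pz Pw; have := mt _ _ _ _ _ _ Pij Pw Pz; lia.
subst i2 i4.
apply: (@forcing_spread _ _ _ _ _ p p') => //.
- lia.
- by have := Pk _ _ Pz; lia.
- move=> i' j' h1 h2 h3; have [h|h] := ltnP i' i.
    have := mt _ _ _ _ _ _ Pf h1 Pij; have := mt _ _ _ _ _ _ h1 Pf Pij.
    by have := mt _ _ _ _ _ _ Ph h1 Pij; have := mt _ _ _ _ _ _ h1 Ph Pij; lia.
  have := mt _ _ _ _ _ _ Pij Pw h1; have := mt _ _ _ _ _ _ Pij h1 Pw.
  by have := mt _ _ _ _ _ _ Pij Pz h1; have := mt _ _ _ _ _ _ Pij h1 Pz; lia.
- move=> i' j' g h1 h2 Pg.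
  have := mt _ _ _ _ _ _ h1 Pg Pz; have := mt _ _ _ _ _ _ h1 Pg Pw.
  have := mt _ _ _ _ _ _ Pf Pg h1; have := mt _ _ _ _ _ _ Ph Pg h1; lia.
- move=> i' j' h1 h2 Pg.
  have := mt _ _ _ _ _ _ h1 Pg Pz; have := mt _ _ _ _ _ _ h1 Pg Pw.
  have := mt _ _ _ _ _ _ Pf Pg h1; have := mt _ _ _ _ _ _ Ph Pg h1; lia.
Qed.

(** * Reflections *)

(** The guard stops truncated subtraction from repeating row 0 beyond the box. *)
Definition flip_rows m (M : nat -> nat -> bool) a b := (a < m) && M (m.-1 - a) b.
Definition flip_cols n (M : nat -> nat -> bool) a b := (b < n) && M a (n.-1 - b).
Definition flip_bd k m (r : nat -> nat) q := m - r (k - q).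

Lemma flip_bdP k m r : boundaries k m r -> boundaries k m (flip_bd k m r).
Proof.
move=> br; split; first by rewrite /flip_bd subn0; case: br => _ [-> _]; rewrite subnn.
split; first by rewrite /flip_bd subnn; case: br => -> _; rewrite subn0.
move=> q qk; rewrite /flip_bd; have := bd_lt br (x := k - q.+1) (y := k - q).
by have := bd_le br (x := k - q) (y := k); case: br => _ [-> _]; lia.
Qed.

Lemma flip_bd_in k m r i a : boundaries k m r -> i < k -> r i <= a < r i.+1 ->
  (a < m) && (flip_bd k m r (k.-1 - i) <= m.-1 - a < flip_bd k m r (k.-1 - i).+1).
Proof.
move=> br ik ha; rewrite /flip_bd; have := bd_end br ik.
have -> : k - (k.-1 - i) = i.+1 by lia.
have -> : k - (k.-1 - i).+1 = i by lia.
lia.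
Qed.

Lemma hits_flip_rows k m M r c i j : boundaries k m r -> i < k -> hits M r c i j ->
  hits (flip_rows m M) (flip_bd k m r) c (k.-1 - i) j.
Proof.
move=> br ik [a [b [ha hb Mab]]]; exists (m.-1 - a), b.
have /andP[am ->] := flip_bd_in br ik ha; split=> //; rewrite /flip_rows.
by rewrite (_ : m.-1 - (m.-1 - a) = a) ?Mab; lia.
Qed.

Lemma hits_flip_cols l n M r c i j : boundaries l n c -> j < l -> hits M r c i j ->
  hits (flip_cols n M) r (flip_bd l n c) i (l.-1 - j).
Proof.
move=> bc jl [a [b [ha hb Mab]]]; exists a, (n.-1 - b).
have /andP[am ->] := flip_bd_in bc jl hb; split=> //; rewrite /flip_cols.
by rewrite (_ : n.-1 - (n.-1 - b) = b) ?Mab; lia.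
Qed.

Lemma hits_sub (M M' : nat -> nat -> bool) r c i j :
  (forall a b, M a b -> M' a b) -> hits M r c i j -> hits M' r c i j.
Proof. by move=> sM [a [b [? ? /sM]]]; exists a, b. Qed.

(** Only an implication, since [M] may be true outside the box; [hits_sub] needs no more. *)
Lemma flip_rowsK m M a b : flip_rows m (flip_rows m M) a b -> M a b.
Proof. by rewrite /flip_rows => /and3P[h1 h2]; rewrite (_ : m.-1 - (m.-1 - a) = a); lia. Qed.

Lemma flip_colsK n M a b : flip_cols n (flip_cols n M) a b -> M a b.
Proof. by rewrite /flip_cols => /and3P[h1 h2]; rewrite (_ : n.-1 - (n.-1 - b) = b); lia. Qed.

Lemma forcing_flip_rows k l P i j : in_box k l P -> P i j ->
  forcing k l (flip_rows k P) (k.-1 - i) j -> forcing k l P i j.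
Proof.
(* The extra probe yields [a < m] even when [N = 0]. *)
move=> Pk Pij [N fN]; exists N.+1 => m n M a y R C pb.
have ik := probe_lt_k Pk Pij.
have [|r [c [br bc rc]]] := fN m n (flip_rows m M) (m.-1 - a) y
    (fun t => flip_bd k m (R t)) C.
  split=> [t tN|t tN|t tN|t tN|t tN|t tN i' j' /andP[ik' Pij'] ne]; last first.
  - have -> : i' = k.-1 - (k.-1 - i') by lia.
    apply: hits_flip_rows; [apply: (probe_rows pb); lia | lia |].
    by apply: (probe_hits pb _ Pij'); lia.
  - have M1 : M a (y t) by apply: (probe_one pb); lia.
    have /andP[am _] := flip_bd_in (probe_rows pb (ltn0Sn N)) ik (probe_row pb (ltn0Sn N)).
    by rewrite /flip_rows (_ : m.-1 - (m.-1 - a) = a) ?M1; lia.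
  - by apply: (probe_col pb); lia.
  - have tN' : t < N.+1 by lia.
    by have /andP[] := flip_bd_in (probe_rows pb tN') ik (probe_row pb tN').
  - by apply: (probe_cols pb); lia.
  - by apply/flip_bdP/(probe_rows pb); lia.
exists (flip_bd k m r), c; split=> //; first exact: flip_bdP.
move=> i' j' Pij'; have ik' := Pk _ _ Pij'.
apply: hits_sub (@flip_rowsK m M) _.
have -> : i' = k.-1 - (k.-1 - i') by lia.
apply: hits_flip_rows => //; first lia.
by apply: rc; rewrite /flip_rows (_ : k.-1 - (k.-1 - i') = i') ?Pij'; lia.
Qed.

(** Reflection reverses left and right, so the probes are listed backwards; an extra one ensures
    that [y N] is a column of the matrix. *)
Lemma forcing_flip_cols k l P i j : in_box k l P -> P i j ->
  forcing k l (flip_cols l P) i (l.-1 - j) -> forcing k l P i j.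
Proof.
move=> Pk Pij [N fN]; exists N.+1 => m n M a y R C pb.
have jl := probe_lt_l Pk Pij.
have yn u : u < N.+1 -> y u < n by apply: (one_lt_n pb Pk Pij).
have [|r [c [br bc rc]]] := fN m n (flip_cols n M) a (fun t => n.-1 - y (N - t))
    (fun t => R (N.-1 - t)) (fun t => flip_bd l n (C (N.-1 - t))).
  split=> [t tN|t tN|t tN|t tN|t tN|t tN i' j' /andP[ik' Pij'] ne]; last first.
  - have -> : j' = l.-1 - (l.-1 - j') by lia.
    apply: hits_flip_cols; [apply: (probe_cols pb); lia | lia |].
    by apply: (probe_hits pb _ Pij'); lia.
  - have M1 : M a (y (N - t)) by apply: (probe_one pb); lia.
    have yt : y (N - t) < n by apply: yn; lia.
    by rewrite /flip_cols (_ : n.-1 - (n.-1 - y (N - t)) = y (N - t)) ?M1; lia.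
  - have tN' : N.-1 - t < N.+1 by lia.
    have bc := probe_cols pb tN'; have := probe_col pb tN'.
    have -> : N - t = (N.-1 - t).+1 by lia.
    have -> : N - t.+1 = N.-1 - t by lia.
    have := yn (N.-1 - t).+1; rewrite /flip_bd.
    have -> : l - (l.-1 - j) = j.+1 by lia.
    have -> : l - (l.-1 - j).+1 = j by lia.
    have := bd_lt bc (x := j) (y := j.+1); have := bd_end bc jl; lia.
  - by apply: (probe_row pb); lia.
  - by apply/flip_bdP/(probe_cols pb); lia.
  - by apply: (probe_rows pb); lia.
exists r, (flip_bd l n c); split=> //; first exact: flip_bdP.
move=> i' j' Pij'; have jl' := Pk _ _ Pij'.
apply: hits_sub (@flip_colsK n M) _.
have -> : j' = l.-1 - (l.-1 - j') by lia.
apply: hits_flip_cols => //; first lia.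
by apply: rc; rewrite /flip_cols (_ : l.-1 - (l.-1 - j') = j') ?Pij'; lia.
Qed.

Lemma in_box_flip_rows k l P : in_box k l P -> in_box k l (flip_rows k P).
Proof. by move=> Pk i j /andP[h1 /Pk]; lia. Qed.

Lemma in_box_flip_cols k l P : in_box k l P -> in_box k l (flip_cols l P).
Proof. by move=> Pk i j /andP[h1 /Pk]; lia. Qed.

Lemma monotone_flip_rows k P : monotone_triples P -> monotone_triples (flip_rows k P).
Proof.
move=> mt i1 i2 i3 j1 j2 j3 /andP[h1 g1] /andP[h2 g2] /andP[h3 g3].
by have := mt _ _ _ _ _ _ g3 g2 g1; lia.
Qed.

Lemma monotone_flip_cols l P : monotone_triples P -> monotone_triples (flip_cols l P).
Proof.
move=> mt i1 i2 i3 j1 j2 j3 /andP[h1 g1] /andP[h2 g2] /andP[h3 g3].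
by have := mt _ _ _ _ _ _ g1 g2 g3; lia.
Qed.

Lemma flip_rowsE k l P i j : in_box k l P -> P i j -> flip_rows k P (k.-1 - i) j.
Proof.
by move=> Pk h; have ij := Pk _ _ h; rewrite /flip_rows (_ : k.-1 - (k.-1 - i) = i) ?h; lia.
Qed.

Lemma flip_colsE k l P i j : in_box k l P -> P i j -> flip_cols l P i (l.-1 - j).
Proof.
by move=> Pk h; have ij := Pk _ _ h; rewrite /flip_cols (_ : l.-1 - (l.-1 - j) = j) ?h; lia.
Qed.

(** * Case analysis on occupied quadrants *)

Definition nw (P : nat -> nat -> bool) i j := exists i' j', P i' j' && (i' < i) && (j' < j).
Definition ne (P : nat -> nat -> bool) i j := exists i' j', P i' j' && (i' < i) && (j < j').
Definition sw (P : nat -> nat -> bool) i j := exists i' j', P i' j' && (i < i') && (j' < j).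
Definition se (P : nat -> nat -> bool) i j := exists i' j', P i' j' && (i < i') && (j < j').

Lemma quadrants_flip_rows k l P i j : in_box k l P -> P i j ->
  let Q := flip_rows k P in let i0 := k.-1 - i in
  [/\ nw Q i0 j <-> sw P i j, sw Q i0 j <-> nw P i j,
      ne Q i0 j <-> se P i j & se Q i0 j <-> ne P i j].
Proof.
move=> Pk /Pk ij Q i0; split; split; move=> [i' [j' /andP[/andP[h h1] h2]]];
  exists (k.-1 - i'), j';
  by [have := flip_rowsE Pk h; have := Pk _ _ h; rewrite /Q; lia
     | case/andP: h => h3 ->; lia].
Qed.

Lemma quadrants_flip_cols k l P i j : in_box k l P -> P i j ->
  let Q := flip_cols l P in let j0 := l.-1 - j in
  [/\ nw Q i j0 <-> ne P i j, ne Q i j0 <-> nw P i j,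
      sw Q i j0 <-> se P i j & se Q i j0 <-> sw P i j].
Proof.
move=> Pk /Pk ij Q j0; split; split; move=> [i' [j' /andP[/andP[h h1] h2]]];
  exists i', (l.-1 - j');
  by [have := flip_colsE Pk h; have := Pk _ _ h; rewrite /Q; lia
     | case/andP: h => h3 ->; lia].
Qed.

Lemma forcing_quadrants k l P i j : in_box k l P -> monotone_triples P -> P i j ->
  [\/ ~ ne P i j /\ ~ se P i j, [/\ nw P i j, se P i j, ~ ne P i j & ~ sw P i j],
     [/\ nw P i j, ne P i j, ~ sw P i j & ~ se P i j]
   | [/\ nw P i j, ne P i j & se P i j]] -> forcing k l P i j.
Proof.
move=> Pk mt Pij [[nne nse]|[hnw hse nne nsw]|[hnw hne nsw nse]|[hnw hne hse]].
- apply: forcing_no_right => // i' j' h h1; case: (ltngtP i' i) => // h2.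
    by case: nne; exists i', j'; rewrite h h1 h2.
  by case: nse; exists i', j'; rewrite h h1 h2.
- apply: forcing_diagonal => // i' j' h h1; rewrite leqNgt; apply/negP => h2.
    by case: nne; exists i', j'; rewrite h h1 h2.
  by case: nsw; exists i', j'; rewrite h h1 h2.
- apply: forcing_north => // i' j' h h1; case: (ltngtP j' j) => // h2.
    by case: nsw; exists i', j'; rewrite h h1 h2.
  by case: nse; exists i', j'; rewrite h h1 h2.
have [hsw|nsw] := classic (sw P i j); first exact: forcing_four_quadrants.
apply: forcing_three_quadrants => // i' j' h h1; rewrite leqNgt; apply/negP => h2.
by case: nsw; exists i', j'; rewrite h h1 h2.
Qed.

(** Either one side of column [j] is empty, or both are occupied; then a reflection of rows, columns
    or both leads to one of the cases of [forcing_quadrants]. *)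
Lemma forcing_monotone_triples k l P i j :
  in_box k l P -> monotone_triples P -> P i j -> forcing k l P i j.
Proof.
move=> Pk mt Pij.
have by_rows := forcing_flip_rows Pk Pij; have by_cols := forcing_flip_cols Pk Pij.
have [r1 r2 r3 r4] := quadrants_flip_rows Pk Pij.
have [c1 c2 c3 c4] := quadrants_flip_cols Pk Pij.
have rbox := in_box_flip_rows Pk; have cbox := in_box_flip_cols Pk.
have rmt := monotone_flip_rows (k := k) mt; have cmt := monotone_flip_cols (l := l) mt.
have Pr := flip_rowsE Pk Pij; have Pc := flip_colsE Pk Pij.
have [d1 d2 d3 d4] := quadrants_flip_rows cbox Pc.
have by_both : forcing k l (flip_rows k (flip_cols l P)) (k.-1 - i) (l.-1 - j) ->
    forcing k l P i j.
  by move=> h; apply: by_cols; apply: (forcing_flip_rows cbox Pc).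
have same := forcing_quadrants Pk mt Pij.
have rows := forcing_quadrants rbox rmt Pr.
have cols := forcing_quadrants cbox cmt Pc.
have both := forcing_quadrants (in_box_flip_rows cbox) (monotone_flip_rows (k := k) cmt)
  (flip_rowsE cbox Pc).
have pick : (~ ne P i j /\ ~ se P i j) \/ (~ nw P i j /\ ~ sw P i j) \/
    (nw P i j /\ se P i j /\ ~ ne P i j /\ ~ sw P i j) \/
    (ne P i j /\ sw P i j /\ ~ nw P i j /\ ~ se P i j) \/
    (nw P i j /\ ne P i j /\ ~ sw P i j /\ ~ se P i j) \/
    (sw P i j /\ se P i j /\ ~ nw P i j /\ ~ ne P i j) \/
    (nw P i j /\ ne P i j /\ se P i j) \/ (ne P i j /\ nw P i j /\ sw P i j) \/
    (sw P i j /\ se P i j /\ ne P i j) \/ (se P i j /\ sw P i j /\ nw P i j).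
  have := classic (nw P i j); have := classic (ne P i j).
  have := classic (sw P i j); have := classic (se P i j); tauto.
case: pick => [[h1 h2]|pick]; first by apply: same; constructor 1.
case: pick => [[h1 h2]|pick]; first by apply/by_cols/cols; constructor 1; tauto.
case: pick => [[h1 [h2 [h3 h4]]]|pick]; first by apply: same; constructor 2.
case: pick => [[h1 [h2 [h3 h4]]]|pick].
  by apply/by_cols/cols; constructor 2; split; tauto.
case: pick => [[h1 [h2 [h3 h4]]]|pick]; first by apply: same; constructor 3.
case: pick => [[h1 [h2 [h3 h4]]]|pick].
  by apply/by_rows/rows; constructor 3; split; tauto.
case: pick => [[h1 [h2 h3]]|pick]; first by apply: same; constructor 4.
case: pick => [[h1 [h2 h3]]|pick]; first by apply/by_cols/cols; constructor 4; split; tauto.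
case: pick => [[h1 [h2 h3]]|[h1 [h2 h3]]].
  by apply/by_rows/rows; constructor 4; split; tauto.
by apply/by_both/both; constructor 4; split; tauto.
Qed.

(** * Matrices as predicates, and the forbidden patterns *)

Definition entry m n (M : 'M[bool]_(m, n)) a b : bool :=
  if insub a is Some a' then if insub b is Some b' then M a' b' else false else false.

Lemma entryE m n (M : 'M[bool]_(m, n)) (a : 'I_m) (b : 'I_n) : entry M a b = M a b.
Proof. by rewrite /entry !valK. Qed.

Lemma entryP m n (M : 'M[bool]_(m, n)) a b : entry M a b ->
  exists (a' : 'I_m) (b' : 'I_n), [/\ a = a', b = b' & M a' b'].
Proof.
rewrite /entry; case: insubP => // a' _ ea; case: insubP => // b' _ eb Mab.
by exists a', b'.
Qed.

Lemma in_box_entry m n (M : 'M[bool]_(m, n)) : in_box m n (entry M).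
Proof. by move=> a b /entryP[a' [b' [-> -> _]]]; rewrite !ltn_ord. Qed.

Lemma minor_entry k l m n (P : 'M[bool]_(k, l)) (M : 'M[bool]_(m, n)) :
  minor k l (entry P) m n (entry M) -> interval_minor P M.
Proof.
move=> [r [c [br bc rc]]]; exists r, c; split=> //; split=> // i j Pij.
have [|a [b [ha hb /entryP[a' [b' [ea eb Mab]]]]]] := rc i j; first by rewrite entryE.
by exists a', b'; rewrite -ea -eb.
Qed.

(** The default [z] of [nth] is the final boundary, at [q = 3]. *)
Definition cut3 x1 x2 z q := nth z [:: 0; x1.+1; x2.+1] q.

Lemma cut3P x1 x2 x3 z : x1 < x2 < x3 -> x3 < z -> boundaries 3 z (cut3 x1 x2 z).
Proof. by move=> h1 h2; split=> //; split=> // -[|[|[|]]] //= _; rewrite /cut3 /=; lia. Qed.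

Lemma cut3_in x1 x2 x3 z q : x1 < x2 < x3 -> x3 < z -> q < 3 ->
  cut3 x1 x2 z q <= nth 0 [:: x1; x2; x3] q < cut3 x1 x2 z q.+1.
Proof. by move=> h1 h2; case: q => [|[|[|]]] //= _; rewrite /cut3 /=; lia. Qed.

Lemma interval_minor_pattern k l (P : 'M[bool]_(k, l)) s i1 i2 i3 j1 j2 j3 :
  i1 < i2 < i3 -> j1 < j2 < j3 -> i3 < k -> j3 < l ->
  (forall q, q \in s ->
     entry P (nth 0 [:: i1; i2; i3] q.1) (nth 0 [:: j1; j2; j3] q.2)) ->
  interval_minor (pattern_of s) P.
Proof.
move=> hi hj ik jl sP; exists (cut3 i1 i2 k), (cut3 j1 j2 l).
split; first exact: cut3P ik. split; first exact: cut3P jl.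
move=> i j; rewrite mxE => /sP /= /entryP[a [b [ea eb Pab]]].
by exists a, b; rewrite -ea -eb; split; [exact: cut3_in | split=> //; exact: cut3_in].
Qed.

(** The four non-monotone orders of three distinct columns are exactly [Q1] to [Q4]. *)
Lemma monotone_triples_entry k l (P : 'M[bool]_(k, l)) :
  ~ interval_minor Q1 P -> ~ interval_minor Q2 P ->
  ~ interval_minor Q3 P -> ~ interval_minor Q4 P -> monotone_triples (entry P).
Proof.
move=> n1 n2 n3 n4 i1 i2 i3 j1 j2 j3 h1 h2 h3 hi hj; apply: contraT => bad.
have b1 := in_box_entry h1; have b2 := in_box_entry h2; have b3 := in_box_entry h3.
have : [\/ j2 < j1 < j3, j3 < j1 < j2, j1 < j3 < j2 | j2 < j3 < j1].
  have [] : [\/ j2 < j1 < j3, j3 < j1 < j2 | (j1 < j3 < j2) || (j2 < j3 < j1)].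
  - case: (ltngtP j1 j2) (ltngtP j2 j3) (ltngtP j1 j3) bad hj => c1 [] c2 [] c3 //= _ _;
      by [constructor 1; lia | constructor 2; lia | constructor 3; lia].
  - by constructor 1. - by constructor 2.
  - by case/orP; [constructor 3 | constructor 4].
case=> o; [case: n1 | case: n2 | case: n3 | case: n4];
  (apply: (@interval_minor_pattern _ _ _ _ i1 i2 i3 _ _ _ hi o); try lia);
  by move=> q; rewrite !inE => /or3P[] /eqP ->.
Qed.

(** * Critical matrices and the counting of 0-runs *)

Lemma bd_block_inj k m r i i' a : boundaries k m r -> i < k -> i' < k ->
  r i <= a < r i.+1 -> r i' <= a < r i'.+1 -> i = i'.
Proof.
move=> br ik ik'; have := bd_le br (x := i.+1) (y := i').
by have := bd_le br (x := i'.+1) (y := i); case: (ltngtP i i') => //; lia.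
Qed.

Record near_miss k l (P : nat -> nat -> bool) m n (M : nat -> nat -> bool) a b i j
    (r c : nat -> nat) : Prop := NearMiss {
  miss_rows : boundaries k m r;
  miss_cols : boundaries l n c;
  miss_row : r i <= a < r i.+1;
  miss_col : c j <= b < c j.+1;
  miss_zero : forall b', c j <= b' < c j.+1 -> ~~ M a b';
  miss_hits : forall i' j', P i' j' -> (i' != i) || (j' != j) -> hits M r c i' j' }.

(** Adding [(a, b)] creates a placement. As [M] avoids [P], some block is missed in [M]; it must
    contain [(a, b)], and blocks are disjoint, so it is the only one. *)
Lemma critical_near_miss k l m n (P : 'M[bool]_(k, l)) (M : 'M[bool]_(m, n)) a b :
  critical (Av P) M -> ~~ M a b -> exists w : ('I_k * 'I_l) * (nat -> nat) * (nat -> nat),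
    P w.1.1.1 w.1.1.2 /\
    near_miss k l (entry P) m n (entry M) a b w.1.1.1 w.1.1.2 w.1.2 w.2.
Proof.
move=> [avM crit] Mab0.
have [r [c [br [bc rc]]]] : interval_minor P (Defs.set1 M a b).
  by apply: NNPP; apply: crit; apply/negbTE.
have hit0 i j : entry P i j ->
    hits (entry M) r c i j \/ (r i <= a < r i.+1) /\ (c j <= b < c j.+1).
  move=> /entryP[i' [j' [-> -> Pij]]]; have [a' [b' [ha [hb]]]] := rc _ _ Pij.
  rewrite mxE; case: ifP => [/andP[/eqP ea /eqP eb] _|_ Mab].
    by right; rewrite -ea -eb.
  by left; exists a', b'; rewrite entryE.
have [i [j [Pij nhit]]] : exists i j, entry P i j /\ ~ hits (entry M) r c i j.
  apply: NNPP => none; apply: avM; apply: minor_entry; exists r, c; split=> // i j Pij.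
  by apply: NNPP => nh; apply: none; exists i, j.
have [//|[ha hb]] := hit0 _ _ Pij.
have [i0 [j0 [ei ej Pij0]]] := entryP Pij; subst i j.
exists (i0, j0, r, c); split=> //; split=> //=.
  by move=> b' hb'; apply/negP => Mab; apply: nhit; exists a, b'.
move=> i' j' Pij' ne; have [//|[ha' hb']] := hit0 _ _ Pij'.
have /andP[ik' jl'] := in_box_entry Pij'.
have := bd_block_inj br (ltn_ord i0) ik' ha ha'.
by have := bd_block_inj bc (ltn_ord j0) jl' hb hb'; lia.
Qed.

Theorem theorem3p18 (k l : nat) (P : 'M[bool]_(k, l)) :
  ~ interval_minor Q1 P -> ~ interval_minor Q2 P ->
  ~ interval_minor Q3 P -> ~ interval_minor Q4 P ->
  row_bounded (Av P).
Proof.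
move=> n1 n2 n3 n4.
have mt := monotone_triples_entry n1 n2 n3 n4.
have [N forceN] : exists N : 'I_k * 'I_l -> nat, forall e, P e.1 e.2 ->
    forall m n M a y R C, probes (N e) k l (entry P) e.1 e.2 m n M a y R C ->
      minor k l (entry P) m n M.
  apply: (@fin_all_exists _ (fun=> nat) (fun e N => P e.1 e.2 -> forall m n M a y R C,
    probes N k l (entry P) e.1 e.2 m n M a y R C -> minor k l (entry P) m n M)) => -[i j] /=.
  have [Pij|_] := boolP (P i j); last by exists 0.
  rewrite -entryE in Pij.
  by have [N fN] := forcing_monotone_triples (@in_box_entry _ _ P) mt Pij; exists N.
(* Pigeonhole: with more runs than this, some position [e] explains at least [(N e).+2] of them. *)
exists (\sum_e (N e).+1) => m n M cM a; rewrite /row_complexity.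
set Z := [set j | _].
have [->|[z0 z0Z]] := set_0Vmem Z; first by rewrite cards0.
have ZM z : z \in Z -> ~~ M a z by rewrite inE => /andP[].
have [w0 _] := critical_near_miss cM (ZM _ z0Z).
have [f fP] : exists f : 'I_n -> ('I_k * 'I_l) * (nat -> nat) * (nat -> nat),
    forall z, z \in Z -> P (f z).1.1.1 (f z).1.1.2 /\
      near_miss k l (entry P) m n (entry M) a z (f z).1.1.1 (f z).1.1.2 (f z).1.2 (f z).2.
  apply: (@fin_all_exists _ _ (fun z w => z \in Z -> P w.1.1.1 w.1.1.2 /\
    near_miss k l (entry P) m n (entry M) a z w.1.1.1 w.1.1.2 w.1.2 w.2)) => z.
  have [zZ|_] := boolP (z \in Z); last by exists w0.
  by have [w wP] := critical_near_miss cM (ZM _ zZ); exists w.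
rewrite -sum1_card (partition_big (fun z => (f z).1.1) predT) //=.
apply: leq_sum => e _; rewrite sum1_card leqNgt; apply/negP.
pose A := [pred z | (z \in Z) && ((f z).1.1 == e)]; rewrite -[#|_|]/(#|A|) => big.
pose z t := nth z0 (enum A) t.
have zA t : t < (N e).+2 -> (z t \in Z) /\ (f (z t)).1.1 = e.
  move=> h; have : z t \in A by rewrite -mem_enum mem_nth // -cardE; apply: leq_trans big.
  by rewrite inE => /andP[-> /eqP].
have zlt t : t.+1 < (N e).+2 -> z t < z t.+1.
  move=> h.
  have srt : sorted (relpre val ltn) (enum A).
    rewrite /enum_mem; apply: sorted_filter; first by move=> ? ? ?; apply: ltn_trans.
    by rewrite -enumT -sorted_map val_enum_ord iota_ltn_sorted.
  apply: (@sorted_ltn_nth _ (relpre val ltn) _ z0 _ srt t t.+1) => //.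
  - by move=> ? ? ?; apply: ltn_trans.
  - by rewrite inE -cardE; apply: leq_trans big; lia.
  - by rewrite inE -cardE; apply: leq_trans big; lia.
(* The start [z 0] is dropped because it may be in column 0; every later start follows a 1-entry,
   which becomes [y t]. *)
have prev t : t <= N e -> entry M a (z t.+1).-1.
  move=> h; have zt := zlt t h.
  have [] := zA t.+1 h; rewrite inE => /andP[_ /orP[/eqP e0|/existsP[b /andP[/eqP eb Mab]]]] _.
    by rewrite e0 in zt.
  by rewrite -eb entryE.
have fz t : t < (N e).+2 -> P e.1 e.2 /\
    near_miss k l (entry P) m n (entry M) a (z t) e.1 e.2 (f (z t)).1.2 (f (z t)).2.
  by move=> h; have [/fP + <-] := zA t h.
have [Pe _] := fz 0 isT.
case: cM => avM _; apply: avM; apply: minor_entry.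
apply: (forceN e Pe m n (entry M) a (fun t => (z t.+1).-1)
  (fun t => (f (z t.+1)).1.2) (fun t => (f (z t.+1)).2)).
split=> [t tN|t tN|t tN|t tN|t tN|t tN]; last 1 first.
- by have [_ /miss_hits] := fz t.+1 (ltnW tN).
- by have [_ /miss_rows] := fz t.+1 (ltnW tN).
- by have [_ /miss_cols] := fz t.+1 (ltnW tN).
- by have [_ /miss_row] := fz t.+1 (ltnW tN).
(* The block contains [z t.+1] and no 1-entry of row [a], so it fits between the 1-entries preceding
   two consecutive starts. *)
- have [_ nm] := fz t.+1 (ltnW tN).
  have := miss_zero nm (b' := (z t.+1).-1); rewrite (prev t (ltnW tN)).
  have := miss_zero nm (b' := (z t.+2).-1); rewrite (prev t.+1 tN).
  have := zlt t; have := zlt t.+1; have := miss_col nm; lia.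
- exact: prev.
Qed.
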